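(* Let $k_1,k_2>0$ and $\delta\in(0,1)$, let $(\vec C,\vec F,\vec D,\vec G)$ be the hybrid system on $\mathbb{R}^9$ defined in the context, and for $\alpha>0$ let $\mathcal H_\alpha=(\vec C_\alpha,\vec F_\alpha,\vec D_\alpha,\vec G_\alpha)$ be its $\alpha$-perturbation. Let $$V(\underline{\boldsymbol q},h)=2(1-h\eta)+\eta'^2+\|\boldsymbol\mu'\|^2,\qquad \underline{\boldsymbol q}=\eta+\boldsymbol\mu+\varepsilon(\eta'+\boldsymbol\mu').$$ Then there exists a class-$\mathcal{KL}$ function $\beta$ such that for each compact set $K\subset\underline{\mathcal S}\times\{-1,1\}$ and each $\Delta>0$ there exists $\alpha^*>0$ such that for each $\alpha\in(0,\alpha^*]$, the solutions $x_\alpha$ from $K$ (i.e. with $x_\alpha(0,0)\in K$) of the perturbed system $\mathcal H_\alpha$ satisfy $$V(x_\alpha(t,j))\le\beta\big(V(x_\alpha(0,0)),\,t+j\big)+\Delta,\qquad\forall (t,j)\in\operatorname{dom}x_\alpha.$$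
   Context: Dual quaternions are $\underline{\boldsymbol q}=\boldsymbol q+\varepsilon\boldsymbol q'=\eta+\boldsymbol\mu+\varepsilon(\eta'+\boldsymbol\mu')$ with $\boldsymbol q=\eta+\boldsymbol\mu$, $\boldsymbol q'=\eta'+\boldsymbol\mu'$ in Hamilton's quaternions $\mathbb{H}$ ($\eta,\eta'\in\mathbb{R}$; $\boldsymbol\mu=\hat\imath\mu_1+\hat\jmath\mu_2+\hat k\mu_3$ and $\boldsymbol\mu'$ similarly are pure imaginary), where $\varepsilon\neq0$ is a central symbol with $\varepsilon^2=0$. They are identified with $\mathbb{R}^8$ via $\operatorname{vec}(\underline{\boldsymbol q})=[\eta,\mu_1,\mu_2,\mu_3,\eta',\mu_1',\mu_2',\mu_3']^T$, with inverse $\underline{\operatorname{vec}}$. The unit dual quaternions are $$\underline{\mathcal S}=\{\boldsymbol q+\varepsilon\boldsymbol q':\|\boldsymbol q\|=1,\ \boldsymbol q\boldsymbol q'^*+\boldsymbol q'\boldsymbol q^*=0\},$$ regarded as a subset of $\mathbb{R}^8$, where $^*$ is quaternion conjugation. $\overset{+}{\boldsymbol H}(\underline{\boldsymbol q})\in\mathbb{R}^{8\times8}$ is the matrix of left multiplication: $\operatorname{vec}(\underline{\boldsymbol q}_1\underline{\boldsymbol q}_2)=\overset{+}{\boldsymbol H}(\underline{\boldsymbol q}_1)\operatorname{vec}(\underline{\boldsymbol q}_2)$ for all dual quaternions. Also $\overline{\operatorname{sgn}}(s)=\{1\}$ if $s>0$, $\{-1\}$ if $s<0$, $\{-1,1\}$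 if $s=0$. For $\boldsymbol x=(x_1,\dots,x_8)\in\mathbb{R}^8$ and $y\in\mathbb{R}$ (with $y$ representing $h$), put $$w(\boldsymbol x,y)=[0,-k_1yx_2,-k_1yx_3,-k_1yx_4,0,-k_2x_1x_6,-k_2x_1x_7,-k_2x_1x_8]^T,$$ $$\vec F(\boldsymbol x,y)=\big(\tfrac12\overset{+}{\boldsymbol H}(\underline{\operatorname{vec}}(\boldsymbol x))\,w(\boldsymbol x,y),\,0\big),\qquad \vec G(\boldsymbol x,y)=\{\boldsymbol x\}\times\overline{\operatorname{sgn}}(x_1),$$ $$\vec C=\{(\boldsymbol x,y)\in\underline{\mathcal S}\times\{-1,1\}: yx_1\ge-\delta\},\qquad \vec D=\{(\boldsymbol x,y)\in\underline{\mathcal S}\times\{-1,1\}: yx_1\le-\delta\}.$$ With $\mathbb{B}$ the closed unit ball of $\mathbb{R}^9$, $+$ the Minkowski sum and $\overline{\mathrm{co}}$ the closed convex hull, the $\alpha$-perturbation is $$\vec C_\alpha=\{x\in\mathbb{R}^9:(x+\alpha\mathbb{B})\cap\vec C\ne\emptyset\},\quad \vec F_\alpha(x)=\overline{\mathrm{co}}\,\vec F\big((x+\alpha\mathbb{B})\cap\vec C\big)+\alpha\mathbb{B}\ \ (x\in\vec C_\alpha),$$ $$\vec D_\alpha=\{x\in\mathbb{R}^9:(x+\alpha\mathbb{B})\cap\vec D\neq\emptyset\},\quad \vec G_\alpha(x)=\{v\in\mathbb{R}^9: v\in g+\alpha\mathbb{B},\ g\in\vec G((x+\alpha\mathbb{B})\cap\vec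 D)\}\ \ (x\in\vec D_\alpha).$$ On $\mathbb{R}^9$ the function $V$ is given by the same formula: $V(\boldsymbol x,y)=2(1-yx_1)+x_5^2+x_6^2+x_7^2+x_8^2$. Hybrid systems: a system with data $(C,F,D,G)$ is $\dot x\in F(x)$ for $x\in C$, $x^+\in G(x)$ for $x\in D$, where $x^+$ is the state after a jump. A solution is a function $x(t,j)$ on a hybrid time domain $\operatorname{dom}x\subset\mathbb{R}_{\ge0}\times\mathbb{N}$ (a union of intervals $[t_j,t_{j+1}]\times\{j\}$ with $0=t_0\le t_1\le\cdots$, the last of which, if any, may be half-open or unbounded). It is locally absolutely continuous in $t$ on each interval, and on each interval with nonempty interior it satisfies $x(t,j)\in C$ for all $t$ in the interior and $\dot x\in F(x)$ for almost every $t$. At each jump time, $x(t_{j+1},j)\in D$ and $x(t_{j+1},j+1)\in G(x(t_{j+1},j))$. A class-$\mathcal{KL}$ function is a continuous $\beta:\mathbb{R}_{\ge0}\times\mathbb{R}_{\ge0}\to\mathbb{R}_{\ge0}$ such that for each fixed $s$, $r\mapsto\beta(r,s)$ is strictly increasing with $\beta(0,s)=0$, and for each fixed $r$, $s\mapsto\beta(r,s)$ is decreasing (in the non-strict sense) with $\lim_{s\to\infty}\beta(r,s)=0$. *)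

(* Defs.v *)
From HB Require Import structures.
From mathcomp Require Import all_boot all_order all_algebra.
From mathcomp Require Import all_classical all_reals all_analysis.
From mathcomp Require Import ring.

Set Implicit Arguments.
Unset Strict Implicit.
Unset Printing Implicit Defensive.

Import Order.TTheory GRing.Theory Num.Theory.
Import numFieldNormedType.Exports.

Local Open Scope classical_set_scope.
Local Open Scope ring_scope.

Section Coordinates.
Variable R : realType.

(* Coordinates are numbered from 1: x = (x_1, ..., x_n). *)
Definition entry n (x : 'cV[R]_n.+1) (k : nat) : R := x (inord k.-1) 0.

Definition col8 (s : seq R) : 'cV[R]_8 := \col_(i < 8) s`_i.

Lemma entry_col8 (s : seq R) k : (0 < k <= 8)%N -> entry (col8 s) k = s`_k.-1.
Proof. by case: k => // k /andP[_ k8]; rewrite /entry mxE inordK. Qed.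

End Coordinates.

Section Quaternions.
Variable R : realType.

(* Quat a b c d is a + b i + c j + d k. *)
Record quat := Quat { qre : R; qi : R; qj : R; qk : R }.

Definition qzero : quat := Quat 0 0 0 0.

Definition qadd (p q : quat) : quat :=
  Quat (qre p + qre q) (qi p + qi q) (qj p + qj q) (qk p + qk q).

Definition qmul (p q : quat) : quat :=
  Quat (qre p * qre q - qi p * qi q - qj p * qj q - qk p * qk q)
       (qre p * qi q + qi p * qre q + qj p * qk q - qk p * qj q)
       (qre p * qj q - qi p * qk q + qj p * qre q + qk p * qi q)
       (qre p * qk q + qi p * qj q - qj p * qi q + qk p * qre q).

Definition qconj (q : quat) : quat := Quat (qre q) (- qi q) (- qj q) (- qk q).

Definition qnorm (q : quat) : R :=
  Num.sqrt (qre q ^+ 2 + qi q ^+ 2 + qj q ^+ 2 + qk q ^+ 2).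

(* DQuat q q' is q + eps q', with eps central and eps ^ 2 = 0. *)
Record dquat := DQuat { dq_std : quat; dq_dual : quat }.

Definition dqmul (p q : dquat) : dquat :=
  DQuat (qmul (dq_std p) (dq_std q))
        (qadd (qmul (dq_std p) (dq_dual q)) (qmul (dq_dual p) (dq_std q))).

Definition unit_dquat (q : dquat) : Prop :=
  qnorm (dq_std q) = 1 /\
  qadd (qmul (dq_std q) (qconj (dq_dual q)))
       (qmul (dq_dual q) (qconj (dq_std q))) = qzero.

Definition vec (q : dquat) : 'cV[R]_8 :=
  let: DQuat (Quat a b c d) (Quat a' b' c' d') := q in
  col8 [:: a; b; c; d; a'; b'; c'; d'].

Definition unvec (x : 'cV[R]_8) : dquat :=
  DQuat (Quat (entry x 1) (entry x 2) (entry x 3) (entry x 4))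
        (Quat (entry x 5) (entry x 6) (entry x 7) (entry x 8)).

Lemma vecK : cancel vec unvec.
Proof. by case=> [[a b c d] [a' b' c' d']]; rewrite /unvec /vec !entry_col8. Qed.

Lemma unvecK : cancel unvec vec.
Proof.
move=> x; apply/matrixP => i j; rewrite ord1 mxE /entry.
by case: i => [[|[|[|[|[|[|[|[|//]]]]]]]] hi] /=; congr (x _ _);
  apply/val_inj; rewrite /= inordK.
Qed.

Definition dqmul_vec (p : dquat) (x : 'cV[R]_8) : 'cV[R]_8 :=
  vec (dqmul p (unvec x)).

Fact dqmul_vec_linear (p : dquat) : linear (dqmul_vec p).
Proof.
case: p => [[a b c d] [a' b' c' d']] s u v; apply/matrixP => i j.
rewrite /dqmul_vec !mxE /unvec /entry !mxE /=.
case: i => [[|[|[|[|[|[|[|[|//]]]]]]]] hi] /=; ring.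
Qed.

HB.instance Definition _ (p : dquat) :=
  GRing.isLinear.Build R 'cV[R]_8 'cV[R]_8 _ (dqmul_vec p) (dqmul_vec_linear p).

(* Matrix of left multiplication by p, column by column; see lmul_mxP. *)
Definition lmul_mx (p : dquat) : 'M[R]_8 :=
  \matrix_(i, j) dqmul_vec p (delta_mx j 0) i 0.

Lemma lmul_mxP (p q : dquat) : vec (dqmul p q) = lmul_mx p *m vec q.
Proof.
rewrite -{1}[q]vecK -/(dqmul_vec p (vec q)); set x := vec q; clearbody x.
rewrite [x in LHS]matrix_sum_delta linear_sum.
apply/matrixP => i j; rewrite ord1 summxE mxE; apply: eq_bigr => k _.
by rewrite big_ord1 linearZ !mxE mulrC.
Qed.

Definition unit_dquats : set 'cV[R]_8 := [set x | unit_dquat (unvec x)].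

End Quaternions.

Section HybridSystems.
Variables (R : realType) (n : nat).
Notation state := 'cV[R]_n.

Record hybrid_system := HybridSystem {
  flow_set : set state;
  flow_map : state -> set state;
  jump_set : set state;
  jump_map : state -> set state }.

Definition slice (E : set (R * nat)) (j : nat) : set R := [set t | E (t, j)].

(* Either there are infinitely many intervals, or interval J is the last one
   and its right bound b is closed, open, or infinite; the comparison of bounds
   BLeft (t J) < b says that this last interval is nonempty. *)
Definition hybrid_time_domain (E : set (R * nat)) : Prop :=
  exists t : nat -> R,
    [/\ t 0%N = 0,
        forall j, t j <= t j.+1
      & (forall j, slice E j = `[t j, t j.+1]%classic) \/
        (exists J, exists b : itv_bound R,
          [/\ forall j, (j < J)%N -> slice E j = `[t j, t j.+1]%classic,
              (BLeft (t J) < b)%O,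
              slice E J = [set` Interval (BLeft (t J)) b]
            & forall j, (J < j)%N -> slice E j = set0])].

Definition abs_continuous (a b : R) (f : R -> state) : Prop :=
  forall eps : R, 0 < eps -> exists2 eta : R, 0 < eta &
    forall (m : nat) (u v : 'I_m -> R),
      (forall i, [/\ a <= u i, u i <= v i & v i <= b]) ->
      (forall i i', i != i' -> v i <= u i' \/ v i' <= u i) ->
      \sum_(i < m) (v i - u i) < eta ->
      \sum_(i < m) `|f (v i) - f (u i)| < eps.

Definition loc_abs_continuous (I : set R) (f : R -> state) : Prop :=
  forall a b : R, a <= b -> `[a, b]%classic `<=` I -> abs_continuous a b f.

(* The arc is x restricted to E; its values outside E are irrelevant. Two
   consecutive slices only share the jump time between them, so (t, j) and
   (t, j.+1) both belong to E exactly when t is the jump time t_{j+1}. *)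
Definition solution (H : hybrid_system) (E : set (R * nat))
    (x : R -> nat -> state) : Prop :=
  [/\ hybrid_time_domain E,
      forall j, loc_abs_continuous (slice E j) (x ^~ j),
      forall j, (forall t : R, (slice E j)° t -> flow_set H (x t j)) /\
        (\forall t \ae (@lebesgue_measure R), (slice E j)° t ->
           exists2 v, flow_map H (x t j) v & is_derive t 1 (x ^~ j) v)
    & forall t j, E (t, j) -> E (t, j.+1) ->
        jump_set H (x t j) /\ jump_map H (x t j) (x t j.+1)].

(* Euclidean, whereas the library's norm on matrices is the sup norm. *)
Definition enorm (x : state) : R := Num.sqrt (\sum_i x i 0 ^+ 2).

Definition unit_ball : set state := [set x | enorm x <= 1].

(* The Minkowski sum A + alpha B, with B the closed unit ball. *)
Definition inflate (alpha : R) (A : set state) : set state :=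
  [set a + alpha *: b | a in A & b in unit_ball].

Definition closed_convex_hull (A : set state) : set state :=
  smallest (fun M : set state => closed M /\ convex_set M) A.

Definition set_image (F : state -> set state) (A : set state) : set state :=
  \bigcup_(z in A) F z.

Definition perturbation (alpha : R) (H : hybrid_system) : hybrid_system :=
  HybridSystem
    [set x | inflate alpha [set x] `&` flow_set H !=set0]
    (fun x => inflate alpha (closed_convex_hull
       (set_image (flow_map H) (inflate alpha [set x] `&` flow_set H))))
    [set x | inflate alpha [set x] `&` jump_set H !=set0]
    (fun x => [set v | exists2 g,
       set_image (jump_map H) (inflate alpha [set x] `&` jump_set H) g &
       inflate alpha [set g] v]).

End HybridSystems.

Section ComparisonFunctions.
Variable R : realType.

(* beta is total on R x R; only its values on nonnegative arguments matter. *)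
Definition class_KL (beta : R -> R -> R) : Prop :=
  [/\ {within [set p : R * R | 0 <= p.1 /\ 0 <= p.2],
         continuous (fun p : R * R => beta p.1 p.2)},
      forall r s : R, 0 <= r -> 0 <= s -> 0 <= beta r s,
      forall s : R, 0 <= s -> beta 0 s = 0 /\
        (forall r r' : R, 0 <= r -> r < r' -> beta r s < beta r' s)
    & forall r : R, 0 <= r ->
        (forall s s' : R, 0 <= s -> s <= s' -> beta r s' <= beta r s) /\
        beta r s @[s --> +oo] --> 0].

End ComparisonFunctions.

Section ClosedLoop.
Variable R : realType.

(* R^9 = R^8 x R: z stands for the pair (xpart z, ypart z). *)
Definition mkstate (x : 'cV[R]_8) (y : R) : 'cV[R]_9 :=
  col_mx x (y%:M : 'cV[R]_1) : 'cV[R]_(8 + 1).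
Definition xpart (z : 'cV[R]_9) : 'cV[R]_8 := usubmx (z : 'cV[R]_(8 + 1)).
Definition ypart (z : 'cV[R]_9) : R := dsubmx (z : 'cV[R]_(8 + 1)) 0 0.

Lemma xpart_mkstate x y : xpart (mkstate x y) = x.
Proof. exact: col_mxKu. Qed.

Lemma ypart_mkstate x y : ypart (mkstate x y) = y.
Proof. by rewrite /ypart /mkstate col_mxKd mxE. Qed.

Lemma mkstate_eta z : mkstate (xpart z) (ypart z) = z.
Proof.
rewrite /mkstate /ypart -mx11_scalar; exact: (@vsubmxK R 8 1 1 z).
Qed.

Definition sgn_bar (s : R) : set R :=
  if 0 < s then [set 1] else if s < 0 then [set -1] else [set -1; 1].

Definition state_space : set 'cV[R]_9 :=
  [set z | unit_dquats (xpart z) /\ [set -1; 1] (ypart z)].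

Variables k1 k2 delta : R.

Definition control (x : 'cV[R]_8) (y : R) : 'cV[R]_8 :=
  col8 [:: 0; - k1 * y * entry x 2; - k1 * y * entry x 3; - k1 * y * entry x 4;
           0; - k2 * entry x 1 * entry x 6; - k2 * entry x 1 * entry x 7;
           - k2 * entry x 1 * entry x 8].

Definition F_cl (z : 'cV[R]_9) : 'cV[R]_9 :=
  let: x := xpart z in
  mkstate (2^-1 *: (lmul_mx (unvec x) *m control x (ypart z))) 0.

Definition G_cl (z : 'cV[R]_9) : set 'cV[R]_9 :=
  [set mkstate (xpart z) y | y in sgn_bar (entry (xpart z) 1)].

Definition C_cl : set 'cV[R]_9 :=
  [set z | state_space z /\ ypart z * entry (xpart z) 1 >= - delta].

Definition D_cl : set 'cV[R]_9 :=
  [set z | state_space z /\ ypart z * entry (xpart z) 1 <= - delta].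

Definition closed_loop : hybrid_system R 9 :=
  HybridSystem C_cl (fun z => [set F_cl z]) D_cl G_cl.

Definition Vfun (z : 'cV[R]_9) : R :=
  let: x := xpart z in
  2 * (1 - ypart z * entry x 1)
    + entry x 5 ^+ 2 + entry x 6 ^+ 2 + entry x 7 ^+ 2 + entry x 8 ^+ 2.

End ClosedLoop.

(* Main.v *)
Require Import Defs.
From mathcomp Require Import all_boot all_order all_algebra.
From mathcomp Require Import all_classical all_reals all_analysis.
From mathcomp Require Import ring lra.
Import Order.TTheory GRing.Theory Num.Theory.
Import numFieldNormedType.Exports.
Local Open Scope classical_set_scope.
Local Open Scope ring_scope.

(* On the unperturbed system V is a strict Lyapunov function. With s = y x_1 and
   W = x_5^2 + ... + x_8^2 one has V = 2 (1 - s) + W, and on the flow set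
   dV/dt = - k_1 (1 - s^2) - k_2 s^2 W <= - a V / (1 + V); a jump lowers V by
   4 |x_1| >= 4 delta >= 2 a. Since a V / (1 + V) >= a V / (1 + r) as long as
   V <= r, beta (r, s) = r exp (- a s / (1 + r)) bounds V along nominal solutions.
   For the perturbed system both estimates hold up to O(alpha) on sublevel sets of
   V, and at a point where V = beta + Delta this error is absorbed by the gap
   between the rates of decay of V and of beta; hence V - beta - Delta cannot
   become positive. *)

(** * Monotonicity of absolutely continuous functions *)

(** Let c be the supremum of the points of [a, b] where P holds. The step carries P from such a
    point just left of c to a point right of c, which either exceeds the supremum or may be taken to
    be b. *)
Lemma real_induction (R : realType) (P : R -> Prop) (a b : R) :
  a <= b -> P a ->
  (forall c, a <= c <= b -> exists2 d : R, 0 < d &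
     forall s t : R, c - d < s <= c -> c <= t < c + d -> a <= s -> t <= b ->
       P s -> P t) ->
  P b.
Proof.
move=> ab Pa step; pose S := [set s | a <= s <= b /\ P s].
have Sa : S a by rewrite /S /= lexx ab.
have ubS : ubound S b by move=> s [/andP[]].
have supS : has_sup S by split; [exists a | exists b].
have ac : a <= sup S by apply: ub_le_sup => //; exists b.
have cb : sup S <= b by apply: ge_sup => //; exists a.
have [|d d0 dP] := step (sup S); first by rewrite ac cb.
have [s [/andP[as_ sb] Ps] cds] := sup_adherent d0 supS.
have sc : s <= sup S by apply: ub_le_sup; [exists b | rewrite /S /= as_ sb].
have [cdb|bcd] := leP (sup S + d / 2) b.
  have Pt : P (sup S + d / 2) by apply: (dP s) => //; lra.
  suff : sup S + d / 2 <= sup S by lra.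
  by apply: ub_le_sup; [exists b | split => //; lra].
by apply: (dP s) => //; lra.
Qed.

Section AbsoluteContinuity.
Variable R : realType.
Implicit Types (f : R -> R) (a b t l : R).

(* The families of non-overlapping intervals are listed from left to right;
   only the indices below m matter. *)
Definition abs_cont a b f := forall eps : R, 0 < eps -> exists2 eta : R, 0 < eta &
  forall (m : nat) (u v : nat -> R),
    (forall i, (i < m)%N -> [/\ a <= u i, u i <= v i & v i <= b]) ->
    (forall i k, (i < k < m)%N -> v i <= u k) ->
    \sum_(i < m) (v i - u i) < eta ->
    \sum_(i < m) `|f (v i) - f (u i)| < eps.

(* The upper strong derivative of f at t, along intervals containing t,
   is nonpositive. *)
Definition slope_le0 f (t : R) := forall eps : R, 0 < eps ->
  exists2 d : R, 0 < d & forall s u : R, t - d < s <= t -> t <= u < t + d ->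
    f u - f s <= eps * (u - s).

(** Outer regularity of Lebesgue measure, applied to a measurable null set that contains N. *)
Lemma negligible_open_cover (N : set R) (eta : R) :
  (@lebesgue_measure R).-negligible N -> 0 < eta ->
  exists U : set R, [/\ open U, N `<=` U & (lebesgue_measure U < eta%:E)%E].
Proof.
move=> [A [mA A0 NA]] eta0.
have [|U [oU AU UA]] := lebesgue_regularity_outer mA _ eta0.
  by rewrite [X in (X < _)%E](_ : _ = 0%E) ?ltry //.
exists U; split=> //; first exact: subset_trans NA AU.
have mU : measurable U := measurable_realfun.open_measurable oU.
have mUA := measurableD mU mA.
have := measureU (@lebesgue_measure R) mA mUA (setDIK _ _).
rewrite setDUK // => ->; rewrite [X in (X + _)%E](_ : _ = 0%E) ?add0e //.
Qed.

(* Cover the exceptional null set by an open U of small measure and sweep [a, b]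
   from left to right: steps inside U are collected in a family whose total
   length is at most the measure of U, so that absolute continuity bounds the
   growth of f over it; the other steps grow by at most e1 times their length. *)
Lemma abs_cont_slope_le0 a b f : a <= b -> abs_cont a b f ->
  (\forall t \ae (@lebesgue_measure R), a < t < b -> slope_le0 f t) ->
  f b <= f a.
Proof.
move=> ab acf slf; apply/ler_addgt0Pr => e e0.
(* Half of e pays for the slopes outside U, half for the intervals inside U; the added 1 keeps the
   denominator positive when a = b. *)
pose e1 := e / 2 / (b - a + 1).
have e10 : 0 < e1 by rewrite !divr_gt0 //; lra.
have e1b : e1 * (b - a) <= e / 2.
  rewrite /e1 -mulrA ler_piMr //; first by lra.
  by rewrite mulrC ler_pdivrMr ?mul1r; lra.
have [eta eta0 etaP] := acf (e / 2) (ltac:(lra)).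
(* The endpoints join the null set: no slope is assumed at a or b, so the sweep has to cross them
   inside U. *)
have negN : (@lebesgue_measure R).-negligible
    (~` [set t | a < t < b -> slope_le0 f t] `|` ([set a] `|` [set b])).
  apply: negligibleU; first exact: slf.
  by apply: negligibleU; [exists [set a] | exists [set b]]; split=> //;
    exact: lebesgue_measure_set1.
have [U [oU NU muU]] := negligible_open_cover _ _ negN eta0.
have mU : measurable U := measurable_realfun.open_measurable oU.
have mUI (s : R) : measurable (U `&` `[a, s[) by exact: measurableI.
(* State of the sweep at s: the intervals collected so far inside U, their total length, and the
   growth of f accounted for up to s. *)
pose P s := exists (m : nat) (u v : nat -> R),
  [/\ forall i, (i < m)%N -> [/\ a <= u i, u i <= v i & v i <= s],
      forall i k, (i < k < m)%N -> v i <= u k,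
      ((\sum_(i < m) (v i - u i))%:E <= lebesgue_measure (U `&` `[a, s[))%E
    & f s - f a <= e1 * (s - a) + \sum_(i < m) `|f (v i) - f (u i)|].
suff [m [u [v [uvb uv len fba]]]] : P b.
  have : \sum_(i < m) `|f (v i) - f (u i)| < e / 2.
    apply: etaP => //.
    rewrite -lte_fin (le_lt_trans len) // (le_lt_trans _ muU) //.
    by apply: le_measure; rewrite ?inE //; exact: mUI.
  by lra.
apply: (@real_induction R P a b) => //.
  exists 0%N, (fun=> 0), (fun=> 0); split => //.
  - by rewrite big_ord0.
  - by rewrite big_ord0 !subrr mulr0 addr0.
move=> c /andP[ac cb]; have [Uc|nUc] := pselect (U c).
  have /nbhs_ballP[d /= d0 dU] := open_nbhs_nbhs (conj oU Uc).
  exists d => // s t /andP[cds sc] /andP[ct tcd] as_ tb.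
  move=> [m [u [v [uvs uv len fsa]]]].
  (* Near a point of U the interval [s, t] is appended to the family, at index m. *)
  pose u' i := if (i < m)%N then u i else s.
  pose v' i := if (i < m)%N then v i else t.
  have sumE (g : R -> R -> R) :
      \sum_(i < m.+1) g (v' i) (u' i) = \sum_(i < m) g (v i) (u i) + g t s.
    rewrite big_ord_recr /= /u' /v' ltnn; congr (_ + _).
    by apply: eq_bigr => i _; rewrite ltn_ord.
  exists m.+1, u', v'; split.
  - move=> i _; rewrite /u' /v'; case: ifPn => [im|_]; last by split; lra.
    by have [? ? ?] := uvs _ im; split; lra.
  - move=> i k /andP[ik]; rewrite ltnS leq_eqVlt => /orP[/eqP km|km].
      rewrite /u' /v' km ltnn -km ik.
      by have [|_ _] := uvs i => //; rewrite -km.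
    by rewrite /u' /v' km (ltn_trans ik km); apply: uv; rewrite ik.
  - rewrite (sumE (fun x y => x - y)) EFinD.
    apply: (@le_trans _ _
      (lebesgue_measure (U `&` `[a, s[) + lebesgue_measure `[s, t[%classic)%E).
      apply: leeD => //; rewrite lebesgue_measure_itv /= lte_fin.
      case: ltP => // ts; rewrite lee_fin; lra.
    rewrite -measureU; [|exact: mUI|exact: measurable_itv|]; last first.
      rewrite -subset0 => r [[_ /=]]; rewrite !in_itv /=; lra.
    apply: le_measure; rewrite ?inE; [|exact: mUI|].
      by apply: measurableU; [exact: mUI|exact: measurable_itv].
    move=> r [[Ur]|] /=; rewrite !in_itv /= => /andP[h1 h2].
      by split=> //; lra.
    by split; [apply: dU; rewrite -ball_normE /= ltr_norml; lra | lra].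
  - rewrite (sumE (fun x y => `|f x - f y|)).
    have := ler_norm (f t - f s).
    have : 0 <= e1 * (t - s) by apply: mulr_ge0; lra.
    rewrite !mulrBr; lra.
have acb : a < c < b.
  rewrite !lt_neqAle ac cb !andbT; apply/andP; split; apply/negP => /eqP cE;
    apply: nUc; apply: NU; right; [left|right]; rewrite /= ?cE //.
have slc : slope_le0 f c.
  by apply: contrapT => nsl; apply: nUc; apply: NU; left => /(_ acb).
have [d d0 dP] := slc _ e10.
exists d => // s t cs ct as_ tb [m [u [v [uvs uv len fsa]]]].
have st : s <= t by lra.
exists m, u, v; split => //.
- by move=> i /uvs[]; split=> //; lra.
- apply: (le_trans len).
  apply: le_measure; rewrite ?inE; [exact: mUI|exact: mUI|] => r [Ur] /=.
  by rewrite !in_itv /= => ?; split => //; lra.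
- have := dP _ _ cs ct; rewrite !mulrBr; lra.
Qed.

Lemma is_derive_littleo f t l : is_derive t 1 f l -> forall eps : R, 0 < eps ->
  exists2 d : R, 0 < d & forall u, `|u - t| < d ->
    `|f u - f t - l * (u - t)| <= eps * `|u - t|.
Proof.
move=> [dft dfl] eps eps0.
have : (fun h : R => h^-1 *: (f (h *: 1 + t) - f t)) @ 0^' --> l.
  by rewrite -dfl.
move=> /cvgrPdist_lt /(_ _ eps0) /nbhs_ballP[d /= d0 dP].
exists d => // u ut; have [->|ut0] := eqVneq u t.
  by rewrite !subrr mulr0 subr0 normr0 mulr0.
have h0 : u - t != 0 by rewrite subr_eq0.
have := dP (u - t) _ h0; rewrite -ball_normE /= sub0r normrN => /(_ ut).
rewrite /GRing.scale /= mulr1 subrK -normrN opprB => /ltW qle.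
rewrite -(ler_pM2r (x := `|u - t|)) ?normr_gt0 // -normrM in qle.
by rewrite mulrBl mulrAC mulVf // mul1r in qle.
Qed.

Definition clip01 (x : R) := Num.min (Num.max x 0) 1.

(** Clipping is nondecreasing and 1-Lipschitz; the one-sided form also transfers bounds on the
    slope. *)
Lemma clip01_sub_le (x y e : R) : 0 <= e -> x - y <= e -> clip01 x - clip01 y <= e.
Proof.
move=> e0 xye; rewrite /clip01; case: (leP x 0) => ?; case: (leP y 0) => ?;
  case: (leP (0 : R) 1) => ?; case: (leP x 1) => ?; case: (leP y 1) => ?; lra.
Qed.

Lemma abs_cont_clip01 a b f : abs_cont a b f -> abs_cont a b (clip01 \o f).
Proof.
move=> acf e /acf[eta eta0 H]; exists eta => // m u v uv dis len.
apply: le_lt_trans (H _ _ _ uv dis len); apply: ler_sum => i _ /=.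
rewrite ler_norml; apply/andP; split; last first.
  by apply: clip01_sub_le => //; exact: ler_norm.
rewrite lerNl opprB; apply: clip01_sub_le => //.
by rewrite -normrN opprB ler_norm.
Qed.

(** If f t lies outside [0, 1], the clipped function is constant near t. Otherwise l <= 0, and
    clipping does not enlarge positive increments. *)
Lemma slope_le0_clip01 f t l : is_derive t 1 f l ->
  (0 <= f t <= 1 -> l <= 0) -> slope_le0 (clip01 \o f) t.
Proof.
move=> fl fl0 e e0.
have near_ft (r : R) : 0 < r -> exists2 d : R, 0 < d &
    forall s, `|s - t| < d -> `|f s - f t| < r.
  move=> r0; have [d d0 dP] := is_derive_littleo _ _ _ fl _ (@ltr01 R).
  have l1 : 0 < `|l| + 1 by rewrite ltr_wpDl.
  exists (Num.min d (r / (`|l| + 1))) => [|s].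
    by rewrite lt_min d0 divr_gt0.
  rewrite lt_min => /andP[/dP sd]; rewrite ltr_pdivlMr // => sr.
  have := ler_normD (f s - f t - l * (s - t)) (l * (s - t)).
  by rewrite subrK normrM; lra.
have [ft0|ft0] := ltP (f t) 0.
  have [|d d0 dP] := near_ft (- f t); first by lra.
  exists d => // s u ? ?.
  have clip0 x : `|x - t| < d -> clip01 (f x) = 0.
    move=> /dP; rewrite ltr_norml => fx; rewrite /clip01 max_r; last by lra.
    by rewrite min_l.
  by rewrite /= !clip0 ?ltr_norml ?subrr ?mulr_ge0 //; lra.
have [ft1|ft1] := ltP 1 (f t).
  have [|d d0 dP] := near_ft (f t - 1); first by lra.
  exists d => // s u ? ?.
  have clip1 x : `|x - t| < d -> clip01 (f x) = 1.
    move=> /dP; rewrite ltr_norml => fx; rewrite /clip01 min_r //.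
    by rewrite le_max; apply/orP; left; lra.
  by rewrite /= !clip1 ?ltr_norml ?subrr ?mulr_ge0 //; lra.
have l0 : l <= 0 by apply: fl0; rewrite ft0.
have [d d0 dP] := is_derive_littleo _ _ _ fl _ e0.
exists d => // s u /andP[s1 s2] /andP[u1 u2]; apply: clip01_sub_le.
  by rewrite mulr_ge0; lra.
have lu : l * (u - t) <= 0 by rewrite mulr_le0_ge0 //; lra.
have ls : l * (t - s) <= 0 by rewrite mulr_le0_ge0 //; lra.
have := dP u; have := dP s.
rewrite (ger0_norm (x := u - t)); last lra.
rewrite -normrN (ger0_norm (x := - (s - t))); last lra.
move=> /(_ ltac:(lra)) /ler_normlP[+ _] /(_ ltac:(lra)) /ler_normlP[_ +].
rewrite !mulrBr in lu ls *; lra.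
Qed.

(* Clipping the values to [0, 1] removes the points where nothing is assumed
   on the derivative. *)
Lemma abs_cont_barrier a b f : a <= b -> abs_cont a b f ->
  (\forall t \ae (@lebesgue_measure R), a < t < b ->
     exists2 l, is_derive t 1 f l & (0 <= f t <= 1 -> l <= 0)) ->
  f a <= 0 -> f b <= 0.
Proof.
move=> ab acf df fa.
have : (clip01 \o f) b <= (clip01 \o f) a.
  apply: abs_cont_slope_le0 (abs_cont_clip01 _ _ _ acf) _ => //.
  apply: negligibleS df; apply: subsetC => t H atb; have [l fl l0] := H atb.
  exact: slope_le0_clip01 fl l0.
rewrite /= /clip01 (max_r fa) (min_l ler01).
by rewrite ge_min ge_max lexx andbT ler10 orbF.
Qed.

End AbsoluteContinuity.

(** * Absolutely continuous arcs in R^n *)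

Section AbsolutelyContinuousArcs.
Variables (R : realType) (n : nat) (a b : R) (x : R -> 'cV[R]_n).
Hypothesis acx : abs_continuous a b x.

(** Passes absolute continuity from the arc to a scalar function of time and state; the term v - u
    accounts for the explicit dependence on time. *)
Lemma abs_cont_lipschitz (f : R -> R) (L : R) : 0 < L ->
  (forall u v, a <= u -> u <= v -> v <= b ->
     `|f v - f u| <= L * ((v - u) + `|x v - x u|)) ->
  abs_cont R a b f.
Proof.
move=> L0 fL e e0; have e2 : 0 < e / 2 / L by rewrite !divr_gt0.
have [eta eta0 etaP] := acx _ e2.
exists (Num.min eta (e / 2 / L)) => [|m u v uv dis].
  by rewrite lt_min eta0.
rewrite lt_min => /andP[len1 len2].
have sumx : \sum_(i < m) `|x (v i) - x (u i)| < e / 2 / L.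
  apply: (etaP m (fun i => u i) (fun i => v i)) => // [i|i k ik].
    exact: uv.
  have := ik; rewrite neq_ltn => /orP[ik'|ki].
    by left; apply: dis; rewrite ik' /=.
  by right; apply: dis; rewrite ki /=.
apply: (@le_lt_trans _ _
    (\sum_(i < m) L * ((v i - u i) + `|x (v i) - x (u i)|))).
  by apply: ler_sum => i _; have [] := uv _ (ltn_ord i) => *; apply: fL.
rewrite -mulr_sumr big_split /= -ltr_pdivlMl // mulrC; lra.
Qed.

Lemma abs_continuous_unif (e : R) : 0 < e -> exists2 d : R, 0 < d &
  forall u v, a <= u -> u <= v -> v <= b -> v - u < d -> `|x v - x u| < e.
Proof.
move=> e0; have [d d0 dP] := acx _ e0; exists d => // u v au uv vb uvd.
have := dP 1%N (fun=> u) (fun=> v); rewrite !big_ord1; apply => // i j.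
by rewrite !ord1 eqxx.
Qed.

(** Real induction: over a step shorter than the modulus of uniform continuity for 1, the bound
    grows by at most 1. *)
Lemma abs_continuous_bounded : a <= b ->
  exists B, forall t, a <= t <= b -> `|x t| <= B.
Proof.
move=> ab; have [d d0 dP] := abs_continuous_unif _ (@ltr01 R).
apply: (@real_induction R (fun t =>
  exists B, forall s, a <= s <= t -> `|x s| <= B) a b) => //.
  by exists `|x a| => s; rewrite -eq_le => /eqP <-.
move=> c /andP[ac cb]; exists (d / 2) => [|s t sc ct as_ tb [B HB]].
  by lra.
exists (B + 1) => r /andP[ar rt]; have [rs|sr] := leP r s.
  by have := HB r; rewrite ar rs => /(_ isT); lra.
have := HB s; rewrite as_ lexx => /(_ isT).
have := dP s r as_ (ltW sr) ltac:(lra) ltac:(lra).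
by have := ler_normD (x r - x s) (x s); rewrite subrK; lra.
Qed.

End AbsolutelyContinuousArcs.

(** * The Lyapunov function and its gradient *)

Section Inflation.
Variables (R : realType) (n : nat).
Implicit Types (z v : 'cV[R]_n) (A : set 'cV[R]_n).

(** A sublevel set of a continuous linear form is closed and convex, so it contains the hull once it
    contains A. With f the differential of V, this reduces the perturbed flow map to single values
    of F. *)
Lemma closed_convex_hull_le (f : 'cV[R]_n -> R) A (c : R) :
  scalar f -> continuous f -> (forall v, A v -> f v <= c) ->
  forall v, closed_convex_hull A v -> f v <= c.
Proof.
move=> linf contf fA; apply: smallest_sub => //; split.
  apply: (@preimage_closed _ _ f [set r | r <= c]); last exact: closed_le.
  by move=> v _; exact: contf.
have fZ r v : f (r *: v) = r * f v.
  have f0 : f 0 = 0 by have := linf 1 0 0; rewrite scale1r addr0 mul1r; lra.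
  by rewrite -[r *: v]addr0 linf f0 addr0.
move=> u v t /[!inE] /= fu fv.
have -> : conv t u v = t%:num *: u + (1 - t%:num) *: v by [].
rewrite linf fZ.
have r0 : 0 <= t%:num :> R by [].
have r1 : 0 <= 1 - t%:num :> R by rewrite subr_ge0.
have := ler_wpM2l r0 fu; have := ler_wpM2l r1 fv; lra.
Qed.

Lemma unit_ball_coord v i : unit_ball v -> `|v i 0| <= 1.
Proof.
rewrite /unit_ball /enorm /= => v1.
have : \sum_k v k 0 ^+ 2 <= 1.
  by rewrite -(ler_sqrt _ ler01) sqrtr1.
rewrite (bigD1 i) //= => vi; rewrite -(ler_pXn2r (n := 2)) ?nnegrE //.
rewrite real_normK ?num_real // expr1n (le_trans _ vi) // lerDl.
by apply: sumr_ge0 => k _; exact: sqr_ge0.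
Qed.

Lemma inflate1_coord (r : R) z v i : 0 <= r ->
  inflate r [set z] v -> `|v i 0 - z i 0| <= r.
Proof.
move=> r0 [_ ->] [b b1 <-]; rewrite !mxE addrAC subrr add0r normrM ger0_norm //.
by rewrite ler_piMr // unit_ball_coord.
Qed.

Lemma mx_coord_le_norm (z : 'cV[R]_n) i : `|z i 0| <= `|z|.
Proof.
by rewrite [leRHS]/Num.norm /= mx_normrE; apply: (le_bigmax _ _ (i, 0)).
Qed.

Lemma is_derive_coord (x : R -> 'cV[R]_n) (t : R) v i :
  is_derive t 1 x v -> is_derive t 1 (fun s => x s i 0) (v i 0).
Proof.
move=> [dx <-]; split; first by move/derivable_mxP: dx.
by rewrite derive_mx // mxE.
Qed.

End Inflation.

Section NormBounds.
Variable R : realType.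
Implicit Types p q P Q : R.

Lemma normrM_le p q P Q : `|p| <= P -> `|q| <= Q -> `|p * q| <= P * Q.
Proof. by move=> pP qQ; rewrite normrM ler_pM. Qed.

Lemma normrD_le p q P Q : `|p| <= P -> `|q| <= Q -> `|p + q| <= P + Q.
Proof. by move=> pP qQ; rewrite (le_trans (ler_normD _ _)) ?lerD. Qed.

Lemma normrN_le p P : `|p| <= P -> `|- p| <= P.
Proof. by rewrite normrN. Qed.

End NormBounds.

Section Lyapunov.
Variable R : realType.
Implicit Types z v : 'cV[R]_9.

Local Notation co z k := (entry (xpart z) k).
Local Notation yo z := (ypart z).

Definition xidx (k : nat) : 'I_9 := lshift 1 (inord k.-1 : 'I_8).
Definition yidx : 'I_9 := rshift 8 (ord0 : 'I_1).

Lemma xpartE z k : co z k = z (xidx k) 0.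
Proof. by rewrite /entry mxE. Qed.

Lemma ypartE z : yo z = z yidx 0.
Proof. by rewrite /ypart mxE. Qed.

(** The differential of V at z applied to v. The direction of y is included because the perturbed
    flow map adds a ball of R^9, so that y may drift. *)
Definition Vgrad z v : R :=
  - 2 * (yo z * co v 1 + co z 1 * yo v)
  + 2 * (co z 5 * co v 5 + co z 6 * co v 6 + co z 7 * co v 7 + co z 8 * co v 8).

Lemma Vgrad_scalar z : scalar (Vgrad z).
Proof.
by move=> c u v; rewrite /Vgrad !xpartE !ypartE !mxE; ring.
Qed.

Lemma Vgrad_continuous z : continuous (Vgrad z).
Proof.
have cc i : continuous (fun v : 'cV[R]_9 => v i 0) by exact: coord_continuous.
have cM (c : R) (f : 'cV[R]_9 -> R) v : {for v, continuous f} ->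
    {for v, continuous (fun v : 'cV[R]_9 => c * f v)}.
  by move=> cf; apply: (@cvgM _ _ (nbhs v)) => //; exact: cvg_cst.
have cD (f g : 'cV[R]_9 -> R) v : {for v, continuous f} ->
    {for v, continuous g} -> {for v, continuous (fun v : 'cV[R]_9 => f v + g v)}.
  by move=> cf cg; apply: (@cvgD _ _ _ (nbhs v)).
rewrite /Vgrad => v.
under eq_fun do rewrite !xpartE !ypartE.
apply: (cD (fun v => _) (fun v => _)); apply: (cM _ (fun v => _)).
  by apply: (cD (fun v => _) (fun v => _)); apply: cM; exact: cc.
do 3![apply: (cD (fun v => _) (fun v => _)); last by apply: cM; exact: cc].
by apply: cM; exact: cc.
Qed.

Lemma is_derive_sqr (f : R -> R) (t l : R) :
  is_derive t 1 f l -> is_derive t 1 (fun s => f s ^+ 2) (2 * f t * l).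
Proof.
move=> df; have -> : (fun s => f s ^+ 2) = f * f by [].
by apply: is_derive_eq; rewrite /GRing.scale /=; ring.
Qed.

Lemma is_derive_Vfun (x : R -> 'cV[R]_9) (t : R) v :
  is_derive t 1 x v -> is_derive t 1 ((fun s => Vfun (x s))) (Vgrad (x t) v).
Proof.
move=> dx.
have dco k : is_derive t 1 (fun s => co (x s) k) (co v k).
  by under eq_fun do rewrite xpartE; rewrite xpartE; exact: is_derive_coord.
have dy : is_derive t 1 (fun s => yo (x s)) (yo v).
  by under eq_fun do rewrite ypartE; rewrite ypartE; exact: is_derive_coord.
have dsq k := is_derive_sqr _ _ _ (dco k).
have dM := is_deriveM dy (dco 1%N).
have dZ := is_deriveZ 2 (is_deriveB (is_derive_cst (1 : R) t 1) dM).
have dV := is_deriveD (is_deriveD (is_deriveD (is_deriveD dZ (dsq 5%N))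
  (dsq 6%N)) (dsq 7%N)) (dsq 8%N).
apply: (is_derive_eq dV); rewrite /Vgrad /GRing.scale /=.
move: (co _ _) (co _ _) => *; ring.
Qed.

Definition coord_le (B : R) z :=
  (forall k, (0 < k <= 8)%N -> `|co z k| <= B) /\ `|yo z| <= B.

Lemma coord_leP B z : (forall i, `|z i 0| <= B) -> coord_le B z.
Proof. by move=> zB; split=> [k _|]; rewrite ?xpartE ?ypartE. Qed.

Lemma coord_dist_le z z' (r : R) : (forall i, `|z i 0 - z' i 0| <= r) ->
  (forall k, `|co z k - co z' k| <= r) /\ `|yo z - yo z'| <= r.
Proof. by move=> zr; split=> [k|]; rewrite ?xpartE ?ypartE. Qed.

(** V is quadratic, so its increments factor: the product y x_1 contributes 4 B r and each of the
    four squares 2 B r. *)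
Lemma Vfun_lipschitz B r z z' : coord_le B z -> coord_le B z' ->
  (forall i, `|z i 0 - z' i 0| <= r) -> `|Vfun z - Vfun z'| <= 12 * B * r.
Proof.
move=> [zB zy] [zB' zy'] /coord_dist_le[zz' yy'].
have -> : Vfun z - Vfun z' =
  - 2 * ((yo z - yo z') * co z 1 + yo z' * (co z 1 - co z' 1))
  + (co z 5 - co z' 5) * (co z 5 + co z' 5)
  + (co z 6 - co z' 6) * (co z 6 + co z' 6)
  + (co z 7 - co z' 7) * (co z 7 + co z' 7)
  + (co z 8 - co z' 8) * (co z 8 + co z' 8).
  by rewrite /Vfun; ring.
have sq k : (0 < k <= 8)%N ->
    `|(co z k - co z' k) * (co z k + co z' k)| <= r * (B + B).
  by move=> k8; apply: normrM_le => //; apply: normrD_le; [exact: zB|exact: zB'].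
have -> : 12 * B * r = 2 * (r * B + B * r)
  + r * (B + B) + r * (B + B) + r * (B + B) + r * (B + B) by ring.
do 4![apply: normrD_le; last exact: sq].
apply: normrM_le; first by rewrite normrN ger0_norm.
by apply: normrD_le; apply: normrM_le => //; exact: zB.
Qed.

End Lyapunov.

(** * Decrease along the unperturbed closed loop *)

Section ClosedLoopDecrease.
Variable R : realType.
Variables k1 k2 delta : R.
Hypotheses (hk1 : 0 < k1) (hk2 : 0 < k2).
Hypotheses (hdelta0 : 0 < delta) (hdelta1 : delta < 1).
Implicit Types z v : 'cV[R]_9.

Local Notation co z k := (entry (xpart z) k).
Local Notation yo z := (ypart z).

Lemma F_clE z k : (0 < k <= 8)%N -> co (F_cl k1 k2 z) k = 2^-1 *
  [:: k1 * yo z * (co z 2 ^+ 2 + co z 3 ^+ 2 + co z 4 ^+ 2);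
      - k1 * yo z * co z 1 * co z 2;
      - k1 * yo z * co z 1 * co z 3;
      - k1 * yo z * co z 1 * co z 4;
      k2 * co z 1 * (co z 2 * co z 6 + co z 3 * co z 7 + co z 4 * co z 8)
        + k1 * yo z * (co z 2 * co z 6 + co z 3 * co z 7 + co z 4 * co z 8);
      k2 * co z 1 * (co z 4 * co z 7 - co z 3 * co z 8 - co z 1 * co z 6)
        + k1 * yo z * (co z 8 * co z 3 - co z 7 * co z 4 - co z 5 * co z 2);
      k2 * co z 1 * (co z 2 * co z 8 - co z 4 * co z 6 - co z 1 * co z 7)
        + k1 * yo z * (co z 6 * co z 4 - co z 8 * co z 2 - co z 5 * co z 3);
      k2 * co z 1 * (co z 3 * co z 6 - co z 2 * co z 7 - co z 1 * co z 8)
        + k1 * yo z * (co z 7 * co z 2 - co z 6 * co z 3 - co z 5 * co z 4)]`_k.-1.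
Proof.
move=> k8; rewrite /F_cl xpart_mkstate [LHS]mxE; congr (_ * _).
rewrite -[control _ _ _ _]unvecK -lmul_mxP -/(entry _ k).
rewrite /unvec /control !entry_col8 //=.
case: k k8 => [|[|[|[|[|[|[|[|[|//]]]]]]]]] //= _; ring.
Qed.

Lemma F_cl_bounded (B : R) k : (0 < k <= 8)%N ->
  exists N, forall z, coord_le R B z -> `|co (F_cl k1 k2 z) k| <= N.
Proof.
(* The bound is left as an existential variable, which the rules for sums and products fill in along
   the polynomial. *)
move=> k8; case: k k8 => [|[|[|[|[|[|[|[|[|//]]]]]]]]] //= _; eexists;
  move=> z [zB zy]; rewrite F_clE //= ?expr2;
  repeat first [ exact: zy | apply: zB; done | apply: normrD_le
               | apply: normrM_le | apply: normrN_le | exact: lexx ].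
Qed.

Lemma ypart_F_cl z : yo (F_cl k1 k2 z) = 0.
Proof. by rewrite /F_cl ypart_mkstate. Qed.

Lemma state_spaceP z : state_space z ->
  [/\ co z 1 ^+ 2 + co z 2 ^+ 2 + co z 3 ^+ 2 + co z 4 ^+ 2 = 1,
      co z 1 * co z 5 + co z 2 * co z 6 + co z 3 * co z 7 + co z 4 * co z 8 = 0
    & yo z = -1 \/ yo z = 1].
Proof.
move=> [[n1 orth] yz]; split => //.
  rewrite /qnorm /= in n1; rewrite -[LHS]sqr_sqrtr ?n1 ?expr1n //.
  by rewrite !addr_ge0 ?sqr_ge0.
by move/(congr1 (@qre R)): orth; rewrite /=; lra.
Qed.

Lemma state_space_coord1 z : state_space z ->
  -1 <= yo z * co z 1 <= 1 /\ co z 1 ^+ 2 = (yo z * co z 1) ^+ 2.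
Proof.
move=> /state_spaceP[n1 _ yE].
have s1 : co z 1 ^+ 2 <= 1.
  have := sqr_ge0 (co z 2); have := sqr_ge0 (co z 3).
  by have := sqr_ge0 (co z 4); lra.
by case: yE => ->; rewrite ?mulN1r ?mul1r ?sqrrN; split => //; nra.
Qed.

Lemma Vfun_ge0 z : state_space z -> 0 <= Vfun z.
Proof.
by move=> /state_space_coord1[/andP[_ h] _]; rewrite /Vfun !addr_ge0 ?sqr_ge0 //; lra.
Qed.

(** The first four coordinates and y are at most 1 in absolute value at z', hence at most 2 at z.
    Then y x_1 <= 4, so V <= M leaves at most M + 6 for the squares of the last four coordinates at
    z; moving to z' costs at most 1. *)
Lemma state_space_bound (M : R) z z' : 0 <= M -> state_space z' ->
  (forall i, `|z' i 0 - z i 0| <= 1) -> Vfun z <= M ->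
  coord_le R (M + 8) z /\ coord_le R (M + 8) z'.
Proof.
move=> M0 /state_spaceP[n1 _ yE] /coord_dist_le[zz' yy'].
have sq_le1 (r : R) : r ^+ 2 <= 1 -> `|r| <= 1.
  by move=> r1; rewrite ler_norml; apply/andP; split; nra.
have sq0 := sqr_ge0; move: (sq0 _ (co z' 1)) (sq0 _ (co z' 2)) (sq0 _ (co z' 3))
  (sq0 _ (co z' 4)) => q1 q2 q3 q4.
have y'1 : `|yo z'| <= 1 by case: yE => ->; rewrite ?normrN normr1.
have zk (k : nat) : co z' k ^+ 2 <= 1 -> `|co z k| <= 2 /\ `|co z' k| <= 1.
  move=> /sq_le1 h; split=> //; have := zz' k.
  by move: h; rewrite !ler_norml; lra.
have [[x1 x1'] [x2 x2']] : (`|co z 1| <= 2 /\ `|co z' 1| <= 1) /\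
    (`|co z 2| <= 2 /\ `|co z' 2| <= 1) by split; apply: zk; lra.
have [[x3 x3'] [x4 x4']] : (`|co z 3| <= 2 /\ `|co z' 3| <= 1) /\
    (`|co z 4| <= 2 /\ `|co z' 4| <= 1) by split; apply: zk; lra.
have y2 : `|yo z| <= 2 by move: y'1 yy'; rewrite !ler_norml; lra.
rewrite /Vfun => VM.
have := normrM_le _ _ _ _ _ y2 x1; rewrite ler_norml => /andP[_ yx].
have big (k : nat) : co z k ^+ 2 <= M + 6 ->
    `|co z k| <= M + 8 /\ `|co z' k| <= M + 8.
  move=> h; have : `|co z k| <= M + 7.
    have := sqr_ge0 (co z k - 1); have := sqr_ge0 (co z k + 1).
    by rewrite ler_norml sqrrD sqrrB; lra.
  by have := zz' k; rewrite !ler_norml; lra.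
move: (sq0 _ (co z 5)) (sq0 _ (co z 6)) (sq0 _ (co z 7)) (sq0 _ (co z 8)).
move=> p5 p6 p7 p8.
suff H k : (0 < k <= 8)%N -> `|co z k| <= M + 8 /\ `|co z' k| <= M + 8.
  by split; split=> [k /H[]//|]; lra.
have M8 (p : R) : p <= 2 -> p <= M + 8 by move=> ?; lra.
have M8' (p : R) : p <= 1 -> p <= M + 8 by move=> ?; lra.
case: k => [|[|[|[|[|[|[|[|[|//]]]]]]]]] //= _.
1-4: by split; [exact: M8|exact: M8'].
all: by apply: big; lra.
Qed.

(** The first two terms serve the flow estimate. The third makes the drop 4 delta at a jump worth
    twice the rate: one half for the decay of the comparison function, one half for the
    perturbation. *)
Definition rate : R := Num.min (k1 * (1 - delta) / 4) (Num.min (k2 / 4) (2 * delta)).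

Lemma rate_gt0 : 0 < rate.
Proof.
by rewrite !lt_min; apply/and3P; split; rewrite ?divr_gt0 ?mulr_gt0 ?subr_gt0.
Qed.

Lemma rate_le : [/\ rate <= k1 * (1 - delta) / 4, rate <= k2 / 4 & rate <= 2 * delta].
Proof. by split; rewrite !ge_min lexx ?orbT. Qed.

(** At s = 0, which the flow set allows, the dissipation is k_1 however large W is; hence a decrease
    rate that saturates in V rather than a linear one. *)
Lemma Vgrad_F_cl z : state_space z -> - delta <= yo z * co z 1 ->
  Vgrad R z (F_cl k1 k2 z) <= - (rate * (Vfun z / (1 + Vfun z))).
Proof.
have d1 : 0 < 1 - delta by rewrite subr_gt0.
move=> zS sd; have V0 := Vfun_ge0 _ zS.
have [/andP[_ s1] sE] := state_space_coord1 _ zS.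
have [n1 orth yE] := state_spaceP _ zS.
pose W := co z 5 ^+ 2 + co z 6 ^+ 2 + co z 7 ^+ 2 + co z 8 ^+ 2.
have W0 : 0 <= W by rewrite !addr_ge0 ?sqr_ge0.
have -> : Vgrad R z (F_cl k1 k2 z) = - (k1 * (1 - co z 1 ^+ 2) + k2 * co z 1 ^+ 2 * W).
  have y2 : yo z ^+ 2 = 1 by case: yE => ->; ring.
  rewrite /Vgrad ypart_F_cl !F_clE //=.
  (* Grouped so that the orthogonality relation turns the factor of x_5 into - x_1 x_5, which
     supplies the square missing from W. *)
  transitivity (- k1 * yo z ^+ 2 * (co z 2 ^+ 2 + co z 3 ^+ 2 + co z 4 ^+ 2)
    + k2 * co z 1 * (co z 5 * (co z 2 * co z 6 + co z 3 * co z 7 + co z 4 * co z 8)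
       - co z 1 * (co z 6 ^+ 2 + co z 7 ^+ 2 + co z 8 ^+ 2))); first by field.
  rewrite y2.
  have -> : co z 2 ^+ 2 + co z 3 ^+ 2 + co z 4 ^+ 2 = 1 - co z 1 ^+ 2 by lra.
  have -> : co z 2 * co z 6 + co z 3 * co z 7 + co z 4 * co z 8
    = - (co z 1 * co z 5) by lra.
  by rewrite /W; ring.
rewrite sE lerN2; set s := yo z * co z 1 in sd s1 *.
have VE : Vfun z = 2 * (1 - s) + W by rewrite /Vfun /W /s; ring.
rewrite VE in V0 *; have a0 := rate_gt0; have [a1 a2 _] := rate_le.
have -> : (2 * (1 - s) + W) / (1 + (2 * (1 - s) + W))
    = (2 * (1 - s)) / (1 + (2 * (1 - s) + W)) + W / (1 + (2 * (1 - s) + W)).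
  by rewrite mulrDl.
have u_le : (2 * (1 - s)) / (1 + (2 * (1 - s) + W)) <= 2 * (1 - s).
  by rewrite ler_pdivrMr; nra.
have W_le1 : W / (1 + (2 * (1 - s) + W)) <= 1 by rewrite ler_pdivrMr; lra.
have W_leW : W / (1 + (2 * (1 - s) + W)) <= W by rewrite ler_pdivrMr; nra.
have k1s : k1 * (1 - delta) * (1 - s) <= k1 * (1 - s ^+ 2).
  have -> : 1 - s ^+ 2 = (1 + s) * (1 - s) by ring.
  by rewrite -mulrA ler_pM2l // ler_wpM2r //; lra.
have au : rate * (2 * (1 - s)) <= k1 * (1 - delta) * (1 - s) / 2.
  have := ler_wpM2r (_ : 0 <= 1 - s) a1; move=> /(_ ltac:(lra)); lra.
have := ler_wpM2l (ltW a0) u_le.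
rewrite [rate * (_ + _)]mulrDr; move: W_le1 W_leW.
move: (W / _) (2 * (1 - s) / _) => Wq Uq W_le1 W_leW h.
(* The term in 1 - s uses half of the k_1 dissipation. The term in W is absorbed by k_2 s^2 W when s
   >= 1/2; otherwise it is at most the rate, and the other half of the k_1 dissipation covers it. *)
have [s12|s12] := leP (1 / 2) s.
  have := ler_wpM2l (ltW a0) W_leW.
  have s2 : 1 / 4 <= s ^+ 2 by nra.
  have := ler_wpM2r W0 a2.
  have : k2 / 4 * W <= k2 * s ^+ 2 * W by rewrite ler_wpM2r // ler_pM2l //; lra.
  have := mulr_ge0 (ltW hk1) (_ : 0 <= (1 - delta) * (1 - s)).
  by move=> /(_ ltac:(apply: mulr_ge0; lra)); lra.
have := ler_wpM2l (ltW a0) W_le1.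
have : 0 <= k2 * s ^+ 2 * W
  by apply: mulr_ge0 W0; apply: mulr_ge0 (sqr_ge0 s); exact: ltW.
have : k1 * (1 - delta) * (1 / 2) <= k1 * (1 - delta) * (1 - s).
  by apply: ler_wpM2l; [exact: mulr_ge0 (ltW hk1) (ltW d1) | lra].
lra.
Qed.

End ClosedLoopDecrease.

(** * Decrease along the perturbed closed loop *)

Section PerturbedDecrease.
Variable R : realType.
Variables k1 k2 delta : R.
Hypotheses (hk1 : 0 < k1) (hk2 : 0 < k2).
Hypotheses (hdelta0 : 0 < delta) (hdelta1 : delta < 1).
Implicit Types z v : 'cV[R]_9.

Local Notation co z k := (entry (xpart z) k).
Local Notation yo z := (ypart z).
Local Notation a := (rate R k1 k2 delta).
Local Notation H_ alpha := (perturbation alpha (closed_loop k1 k2 delta)).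

Lemma coord_leW (B B' : R) z : B <= B' -> coord_le R B z -> coord_le R B' z.
Proof.
move=> BB [zB zy]; split=> [k k8|]; last exact: le_trans zy BB.
exact: le_trans (zB k k8) BB.
Qed.

(** The map p / (1 + p) is nondecreasing and 1-Lipschitz on nonnegative reals. *)
Lemma divr1D_le_sub (p q e : R) : 0 <= p -> 0 <= q -> 0 <= e -> q - p <= e ->
  q / (1 + q) <= p / (1 + p) + e.
Proof.
move=> p0 q0 e0 qpe; rewrite ler_pdivrMr; last by lra.
rewrite mulrDl; have -> : p / (1 + p) * (1 + q) = p + p / (1 + p) * (q - p).
  by field; lra.
have [p1 p2] : 0 <= p / (1 + p) /\ p / (1 + p) <= 1.
  by split; [rewrite divr_ge0 //|rewrite ler_pdivrMr]; lra.
by have [?|?] := leP p q; nra.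
Qed.

(** By linearity of the differential it suffices to treat v = F(z') + alpha b with z' in the flow
    set at distance at most alpha from z. The nominal estimate at z' is then moved to z. Off the
    state space V may be negative, hence the lower bound on V. *)
Lemma perturbed_flow_decrease (M : R) : 0 <= M -> exists c : R,
  forall alpha z v, 0 < alpha <= 1 -> 0 <= Vfun z <= M ->
    flow_set (H_ alpha) z -> flow_map (H_ alpha) z v ->
    Vgrad R z v <= - (a * (Vfun z / (1 + Vfun z))) + alpha * c.
Proof.
move=> M0; pose B := M + 8.
have [N1 F1] := F_cl_bounded R k1 k2 B 1 isT.
have [N5 F5] := F_cl_bounded R k1 k2 B 5 isT.
have [N6 F6] := F_cl_bounded R k1 k2 B 6 isT.
have [N7 F7] := F_cl_bounded R k1 k2 B 7 isT.
have [N8 F8] := F_cl_bounded R k1 k2 B 8 isT.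
pose N := 2 * N1 + 2 * (N5 + N6 + N7 + N8).
have a0 := rate_gt0 R k1 k2 delta hk1 hk2 hdelta0 hdelta1.
(* The three errors, in order: V at z against z', the differential of V at z against z', and the
   added ball. *)
exists (12 * B * a + N + 12 * B) => alpha z v /andP[al0 al1] /andP[V0 VM] /=.
move=> [z0 [zz0 [z0S _]]] [w hullw [b b1 <-]].
have d z'' i := inflate1_coord R 9 alpha z z'' i (ltW al0).
have zB z'' : inflate alpha [set z] z'' -> state_space z'' ->
    coord_le R B z /\ coord_le R B z''.
  move=> zz'' z''S.
  by apply: state_space_bound z''S _ VM => // i; apply: le_trans (d _ i zz'') al1.
have bB := coord_leP _ _ _ (fun i => unit_ball_coord _ _ _ i b1).
rewrite [w + _]addrC Vgrad_scalar.
have gb : `|Vgrad R z b| <= 12 * B.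
  have [[zk zy] _] := zB _ zz0 z0S; have [bk b_y] := bB; rewrite /Vgrad.
  have -> : 12 * B = 2 * (B * 1 + B * 1) + 2 * (B * 1 + B * 1 + B * 1 + B * 1) by ring.
  apply: normrD_le; apply: normrM_le; rewrite ?normrN ?normr_nat //;
  by do ![apply: normrD_le | apply: normrM_le]; rewrite ?zk ?bk.
suff : Vgrad R z w <= - (a * (Vfun z / (1 + Vfun z))) + alpha * (12 * B * a + N).
  by move: gb; rewrite ler_norml => /andP[_ gb]; have := ler_wpM2l (ltW al0) gb; lra.
apply: (closed_convex_hull_le R 9 _ _ _ (Vgrad_scalar R z)
  (Vgrad_continuous R z) _ _ hullw).
move=> _ [z' [zz' [z'S z'd]] ->].
have [zB1 z'B] := zB _ zz' z'S.
have dVV : `|Vfun z - Vfun z'| <= 12 * B * alpha.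
  apply: Vfun_lipschitz => // i; rewrite distrC; exact: d.
have nom := Vgrad_F_cl R k1 k2 delta hk1 hk2 hdelta0 hdelta1 _ z'S z'd.
have : `|Vgrad R z (F_cl k1 k2 z') - Vgrad R z' (F_cl k1 k2 z')| <= alpha * N.
  have [dx dy] : (forall k, `|co z k - co z' k| <= alpha) /\ `|yo z - yo z'| <= alpha.
    by apply: coord_dist_le => i; rewrite distrC; exact: d.
  set F := F_cl k1 k2 z'.
  have -> : Vgrad R z F - Vgrad R z' F = - 2 * ((yo z - yo z') * co F 1)
     + 2 * ((co z 5 - co z' 5) * co F 5 + (co z 6 - co z' 6) * co F 6
          + (co z 7 - co z' 7) * co F 7 + (co z 8 - co z' 8) * co F 8).
    by rewrite /Vgrad /F ypart_F_cl; ring.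
  have -> : alpha * N = 2 * (alpha * N1)
    + 2 * (alpha * N5 + alpha * N6 + alpha * N7 + alpha * N8) by rewrite /N; ring.
  apply: normrD_le; apply: normrM_le; rewrite ?normrN ?normr_nat //.
    by apply: normrM_le => //; exact: F1.
  do ![apply: normrD_le]; apply: normrM_le => //;
    [exact: F5|exact: F6|exact: F7|exact: F8].
have V'0 := Vfun_ge0 R _ z'S.
have B0 : 0 <= 12 * B * alpha by rewrite !mulr_ge0 ?addr_ge0 // ltW.
move: dVV; rewrite !ler_norml => /andP[_ dVV] /andP[_ dF].
have := ler_wpM2l (ltW a0) (divr1D_le_sub _ _ _ V'0 V0 B0 dVV).
by lra.
Qed.

Lemma perturbed_jump_decrease (M : R) : 0 <= M -> exists c : R,
  forall alpha z g, 0 < alpha <= 1 -> Vfun z <= M ->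
    jump_map (H_ alpha) z g -> Vfun g <= Vfun z - 4 * delta + alpha * c.
Proof.
(* The points before the jump and the nominal value g' have coordinates up to M + 8, and g is within
   1 of g'. The Lipschitz bound is used twice, from z to z' and from g' to g. *)
move=> M0; pose B := M + 9; exists (24 * B) => alpha z g /andP[al0 al1] VM.
move=> [g' [z' [zz' [z'S z'd]] [y yE g'E]] gg'].
have dz i := inflate1_coord R 9 alpha z z' i (ltW al0) zz'.
have dg i := inflate1_coord R 9 alpha g' g i (ltW al0) gg'.
have [zB z'B] : coord_le R (M + 8) z /\ coord_le R (M + 8) z'.
  by apply: state_space_bound z'S _ VM => // i; apply: le_trans (dz i) al1.
have BM : M + 8 <= B by rewrite /B; lra.
have g'x k : co g' k = co z' k by rewrite -g'E xpart_mkstate.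
have g'y : yo g' = y by rewrite -g'E ypart_mkstate.
have [y2 y1] : `|y| <= 1 /\ y * co z' 1 = `|co z' 1|.
  move: yE; rewrite /sgn_bar; have [x0|x0|x0] := ltgtP 0 (co z' 1).
  - by move=> ->; rewrite normr1 mul1r gtr0_norm.
  - by move=> ->; rewrite normrN normr1 mulN1r ltr0_norm.
  - by rewrite -x0 normr0 mulr0 => -[] ->; rewrite ?normrN normr1.
have g'B : coord_le R (M + 8) g'.
  have [z'k z'y] := z'B; split=> [k k8|]; first by rewrite g'x z'k.
  by rewrite g'y; lra.
have gB : coord_le R B g.
  have [gk gy] := coord_dist_le _ _ _ _ dg; have [g'k g'yB] := g'B.
  split=> [k k8|].
    have := ler_normD (co g k - co g' k) (co g' k); rewrite subrK.
    by have := gk k; have := g'k k k8; rewrite /B; lra.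
  by have := ler_normD (yo g - yo g') (yo g'); rewrite subrK /B; lra.
have Vg : `|Vfun g - Vfun g'| <= 12 * B * alpha.
  by apply: Vfun_lipschitz => //; exact: coord_leW g'B.
have Vz : `|Vfun z - Vfun z'| <= 12 * B * alpha.
  apply: Vfun_lipschitz; [exact: coord_leW zB|exact: coord_leW z'B|].
  by move=> i; rewrite distrC.
have Vg' : Vfun g' <= Vfun z' - 4 * delta.
  rewrite /Vfun !g'x g'y y1.
  have [_ _ y'E] := state_spaceP _ _ z'S.
  have d0 := ltW hdelta0.
  (* On the jump set y and x_1 have opposite signs, and after the jump y x_1 = |x_1|; so V drops by
     4 |x_1|, with |x_1| >= delta. *)
  have : yo z' * co z' 1 = - `|co z' 1|.
    case: y'E z'd => ->; rewrite ?mulN1r ?mul1r => h.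
      by rewrite ger0_norm //; lra.
    by rewrite ler0_norm ?opprK //; lra.
  by lra.
by move: Vg Vz; rewrite !ler_norml; lra.
Qed.

End PerturbedDecrease.

(** * Comparison with the class-KL function *)

Section Comparison.
Variable R : realType.
Implicit Types (a r s : R).

Definition decay a r s := r * expR (- (a / (1 + r) * s)).

(** In r, the exponential factor is nondecreasing too, since the rate a / (1 + r) falls as r
    grows. *)
Lemma class_KL_decay a : 0 < a -> class_KL (decay a).
Proof.
move=> a0.
have rate_ge0 r : 0 <= r -> 0 < a / (1 + r) by move=> r0; rewrite divr_gt0 //; lra.
split.
- apply: continuous_in_subspaceT => p pA; have [/= + _] := set_mem pA.
  case: p {pA} => r s /= r0.
  have r1 : 1 + r != 0 by rewrite gt_eqF //; lra.
  apply: (@cvgM _ _ (nbhs (r, s))); first exact: cvg_fst.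
  apply: (@cvg_comp _ _ _ (fun p : R * R => - (a / (1 + p.1) * p.2)) expR
    (nbhs (r, s)) (nbhs (- (a / (1 + r) * s)))); last exact: continuous_expR.
  apply: (@cvgN _ _ _ (nbhs (r, s))).
  apply: (@cvgM _ _ (nbhs (r, s))); last exact: cvg_snd.
  apply: (@cvgM _ _ (nbhs (r, s))); first exact: cvg_cst.
  apply: (@cvgV _ _ (nbhs (r, s))) => //.
  by apply: (@cvgD _ _ _ (nbhs (r, s))); [exact: cvg_cst|exact: cvg_fst].
- by move=> r s r0 _; rewrite mulr_ge0 // expR_ge0.
- move=> s s0; rewrite /decay mul0r; split=> // r r' r0 rr'.
  apply: (@lt_le_trans _ _ (r' * expR (- (a / (1 + r) * s)))).
    by rewrite ltr_pM2r // expR_gt0.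
  rewrite ler_wpM2l //; first by lra.
  rewrite ler_expR lerN2 ler_wpM2r // ler_pM2l // lef_pV2 ?posrE; lra.
- move=> r r0; split=> [s s' s0 ss'|].
    by rewrite ler_wpM2l // ler_expR lerN2 ler_pM2l // rate_ge0.
  rewrite -[0](mulr0 r); apply: (@cvgM _ _ (pinfty_nbhs R)); first exact: cvg_cst.
  apply: cvg_comp (@cvgr_expR R).
  by apply: gt0_cvgMry => //; exact: rate_ge0.
Qed.

Lemma is_derive_decay a r (j t : R) :
  is_derive t 1 (fun s => decay a r (s + j)) (- (a / (1 + r)) * decay a r (t + j)).
Proof.
rewrite /decay; set k := a / (1 + r).
have dl : is_derive t 1 (- (k \*: (id + cst j))) (- (k *: (1 + 0 : R))).
  by apply: is_deriveN.
have dE := is_derive1_comp (is_derive_expR ((- (k \*: (id + cst j))) t)) dl.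
have -> : (fun s => r * expR (- (k * (s + j))))
    = r \*: (expR \o (- (k \*: (id + cst j)))).
  by [].
apply: is_derive_eq.
transitivity (r * (expR (- (k * (t + j))) * - (k * (1 + 0)))); first by [].
by rewrite addr0 mulr1; ring.
Qed.

Lemma decay_lipschitz a r (j u v : R) : 0 <= a -> 0 <= r -> 0 <= u + j -> u <= v ->
  `|decay a r (v + j) - decay a r (u + j)| <= r * a * (v - u).
Proof.
move=> a0 r0 uj uv; rewrite /decay; set k := a / (1 + r).
rewrite -mulrBr normrM (ger0_norm r0) -(mulrA r a) ler_wpM2l //.
have [k0 ka] : 0 <= k /\ k <= a.
  split; first by rewrite divr_ge0 //; lra.
  rewrite /k ler_pdivrMr; nra.
have -> : - (k * (v + j)) = - (k * (u + j)) - k * (v - u) by ring.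
rewrite expRD; set e := expR (- (k * (u + j))).
have e0 : 0 <= e by exact: expR_ge0.
have e1 : e <= 1 by rewrite expR_le1 oppr_le0 mulr_ge0.
have h := expR_ge1Dx (- (k * (v - u))).
have kv : 0 <= k * (v - u) by rewrite mulr_ge0 // subr_ge0.
have h1 : expR (- (k * (v - u))) <= 1 by rewrite expR_le1 oppr_le0.
have kav : k * (v - u) <= a * (v - u) by rewrite ler_wpM2r // subr_ge0.
rewrite -normrN ger0_norm; nra.
Qed.

Lemma decay_bounds a r s : 0 <= a -> 0 <= r -> 0 <= s -> 0 <= decay a r s <= r.
Proof.
move=> a0 r0 s0; rewrite /decay mulr_ge0 ?expR_ge0 //= ler_piMr //.
by rewrite expR_le1 oppr_le0 mulr_ge0 // divr_ge0 //; lra.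
Qed.

(** A jump advances t + j by 1. With k = a / (1 + r), the loss is at most k times the current value,
    hence at most k r <= a. *)
Lemma decay_step a r s : 0 <= a -> 0 <= r -> 0 <= s ->
  decay a r s - a <= decay a r (s + 1).
Proof.
move=> a0 r0 s0; have /andP[] := decay_bounds a r s a0 r0 s0.
rewrite /decay; set k := a / (1 + r).
have -> : - (k * (s + 1)) = - (k * s) - k by ring.
rewrite expRD mulrA; set m := r * _ => m0 mr.
have k0 : 0 <= k by rewrite divr_ge0 //; lra.
have ka : k * r <= a by rewrite /k mulrAC ler_pdivrMr; nra.
have := ler_wpM2l m0 (expR_ge1Dx (- k)); have := ler_wpM2l k0 mr; lra.
Qed.

Lemma decay0 a r : decay a r 0 = r.
Proof. by rewrite /decay mulr0 oppr0 expR0 mulr1. Qed.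

End Comparison.

Section FlowComparison.
Variable R : realType.
Implicit Types (a M r Delta : R).

(** The perturbation error that the flow tolerates. It bounds below a times V / (1 + V) - m / (1 +
    m) = (V - m) / ((1 + V) (1 + m)), for m <= M and m + Delta <= V <= M + Delta + 1. *)
Definition margin a M Delta := a * (Delta / ((2 + M + Delta) * (1 + M))).

Lemma margin_gt0 a M Delta : 0 < a -> 0 <= M -> 0 < Delta -> 0 < margin a M Delta.
Proof.
by move=> a0 M0 D0; rewrite /margin mulr_gt0 // divr_gt0 // mulr_gt0 //; lra.
Qed.

Lemma rate_gap a M r Delta m V : 0 <= a -> 0 <= m <= r -> r <= M -> 0 < Delta ->
  m + Delta <= V <= m + Delta + 1 ->
  a / (1 + r) * m + margin a M Delta <= a * (V / (1 + V)).
Proof.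
move=> a0 /andP[m0 mr] rM D0 /andP[mV VmD]; rewrite /margin -mulrA -mulrDr.
apply: ler_wpM2l => //.
apply: (@le_trans _ _ (m / (1 + m) + (V - m) / ((1 + V) * (1 + m)))).
  apply: lerD; first by rewrite mulrC ler_wpM2l // lef_pV2 ?posrE; lra.
  apply: ler_pM => //; first by lra.
  - by rewrite invr_ge0 mulr_ge0; lra.
  - by lra.
  - rewrite lef_pV2 ?posrE; [|by rewrite mulr_gt0; lra..].
    by apply: ler_pM; lra.
rewrite le_eqVlt; apply/orP; left; apply/eqP; field.
by apply/andP; split; apply: lt0r_neq0; lra.
Qed.

(** [abs_cont_barrier] is applied to f = V - decay - Delta: where f lies in [0, 1], V is in the
    window of [rate_gap], and the gap pays for the margin. *)
Lemma flow_comparison a M r Delta (x : R -> 'cV[R]_9) (t1 t2 j : R) :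
  0 < a -> 0 <= r <= M -> 0 < Delta -> 0 <= j -> 0 <= t1 -> t1 <= t2 ->
  abs_continuous t1 t2 x ->
  (\forall t \ae (@lebesgue_measure R), t1 < t < t2 -> exists2 v, is_derive t 1 x v &
     (0 <= Vfun (x t) <= M + Delta + 1 ->
      Vgrad R (x t) v <= - (a * (Vfun (x t) / (1 + Vfun (x t)))) + margin a M Delta)) ->
  Vfun (x t1) <= decay R a r (t1 + j) + Delta ->
  Vfun (x t2) <= decay R a r (t2 + j) + Delta.
Proof.
move=> a0 /andP[r0 rM] D0 j0 t10 t12 acx dx V1.
pose f t := Vfun (x t) - (decay R a r (t + j) + Delta).
suff : f t2 <= 0 by rewrite subr_le0.
apply: (abs_cont_barrier R t1 t2 f t12); last by rewrite subr_le0.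
(* V is only locally Lipschitz, so the arc is first bounded on [t1, t2]. *)
- have [B HB] := abs_continuous_bounded _ _ _ _ _ acx t12.
  have B0 : 0 <= B by apply: le_trans (HB t1 _); rewrite ?normr_ge0 ?lexx.
  have coB t : t1 <= t <= t2 -> coord_le R B (x t).
    move=> /HB xB; apply: coord_leP => i.
    exact: le_trans (mx_coord_le_norm _ _ _ _) xB.
  apply: (abs_cont_lipschitz _ _ _ _ _ acx _ (12 * B + r * a + 1)).
    by have := mulr_ge0 r0 (ltW a0); lra.
  move=> u v u1 uv v2.
  have -> : f v - f u = (Vfun (x v) - Vfun (x u))
      - (decay R a r (v + j) - decay R a r (u + j)) by rewrite /f; ring.
  have dV : `|Vfun (x v) - Vfun (x u)| <= 12 * B * `|x v - x u|.
    apply: Vfun_lipschitz; [apply: coB; lra|apply: coB; lra|].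
    by move=> i; have := mx_coord_le_norm _ _ (x v - x u) i; rewrite !mxE.
  have dm := decay_lipschitz R a r j u v (ltW a0) r0 ltac:(lra) uv.
  have := normrD_le _ _ _ _ _ dV (normrN_le _ _ _ dm).
  have : 0 <= r * a * `|x v - x u| by rewrite !mulr_ge0 // ltW.
  have : 0 <= 12 * B * (v - u) by rewrite !mulr_ge0 // subr_ge0.
  by have := normr_ge0 (x v - x u); lra.
- apply: negligibleS dx; apply: subsetC => t H tt; have [v dv Hv] := H tt.
  exists (Vgrad R (x t) v + a / (1 + r) * decay R a r (t + j)).
    have d1 := is_derive_Vfun R x t v dv.
    have d2 := is_derive_decay R a r j t.
    have -> : f = (fun s => Vfun (x s))
      - ((fun s => decay R a r (s + j)) + cst Delta) by [].
    by apply: is_derive_eq; rewrite addr0 mulNr opprK.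
  rewrite /f => /andP[f0 f1].
  have mb : 0 <= decay R a r (t + j) <= r by apply: decay_bounds; lra.
  have /Hv : 0 <= Vfun (x t) <= M + Delta + 1 by lra.
  have := rate_gap a M r Delta (decay R a r (t + j)) (Vfun (x t)) (ltW a0) mb rM D0.
  by move=> /(_ ltac:(lra)); lra.
Qed.

(** Treats both shapes of domain at once for the induction over jumps: each (t, j) is reached by
    flowing from (T j, j), and for j > 0 that point is reached by a jump from slice j - 1. *)
Lemma hybrid_time_domainP (E : set (R * nat)) : hybrid_time_domain E ->
  exists T : nat -> R, [/\ T 0%N = 0, forall j, 0 <= T j &
    forall j t, E (t, j) -> [/\ T j <= t, `[T j, t] `<=` slice E j, E (T j, j) &
      forall i, j = i.+1 -> E (T j, i)]].
Proof.
move=> [T [T0 Tmon HE]]; exists T; split=> //.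
  by elim=> [|j IH]; [rewrite T0|exact: le_trans IH (Tmon j)].
move=> j t Etj.
have last_pt i : slice E i = `[T i, T i.+1]%classic -> E (T i.+1, i).
  move=> Ei; suff : slice E i (T i.+1) by [].
  by rewrite Ei /= in_itv /= Tmon lexx.
have closed_case i s : slice E i = `[T i, T i.+1]%classic -> E (s, i) ->
    T i <= s /\ `[T i, s] `<=` slice E i.
  move=> Ei Esi; have : slice E i s by []; rewrite Ei /= in_itv /=.
  move=> /andP[Ts sT]; split=> // u /=; rewrite !in_itv /= => /andP[-> us] /=.
  exact: le_trans us sT.
have [Tt sub] : T j <= t /\ `[T j, t] `<=` slice E j.
  case: HE => [HE|[J [b [HE JB EJ E0]]]]; first exact: closed_case.
  have [jJ|Jj|jJ] := ltngtP j J; first exact: closed_case (HE _ jJ) Etj.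
    by have : slice E j t by []; rewrite E0.
  rewrite jJ in Etj *; have : slice E J t by [].
  rewrite EJ /= itv_boundlr bnd_simp => /andP[TJt tb]; split=> //.
  exact: subset_itvl.
split=> //; first by apply: sub; rewrite /= in_itv /= lexx Tt.
move=> i ji; case: HE => [HE|[J [b [HE JB EJ E0]]]]; rewrite ji; apply: last_pt => //.
apply: HE; rewrite ltnNge; apply/negP => Ji.
by have : slice E j t by []; rewrite E0 // ji ltnS.
Qed.

End FlowComparison.

(** * Choice of the perturbation size and induction over jumps *)

Theorem theorem6 (R : realType) (k1 k2 delta : R)
    (hk1 : 0 < k1) (hk2 : 0 < k2) (hdelta0 : 0 < delta) (hdelta1 : delta < 1) :
  exists beta : R -> R -> R, class_KL beta /\
    forall K : set 'cV[R]_9, compact K -> K `<=` state_space (R := R) ->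
    forall Delta : R, 0 < Delta ->
    exists2 alpha_star : R, 0 < alpha_star &
    forall alpha : R, 0 < alpha -> alpha <= alpha_star ->
    forall (E : set (R * nat)) (x : R -> nat -> 'cV[R]_9),
      solution (perturbation alpha (closed_loop k1 k2 delta)) E x ->
      K (x 0 0%N) ->
      forall (t : R) (j : nat), E (t, j) ->
        Vfun (x t j) <= beta (Vfun (x 0 0%N)) (t + j%:R) + Delta.
Proof.
pose a := rate R k1 k2 delta.
have a0 : 0 < a by exact: rate_gt0.
exists (decay R a); split; first exact: class_KL_decay.
move=> K cptK KS Delta D0.
have [M M0 VM] : exists2 M : R, 0 <= M & forall z, K z -> Vfun z <= M.
  have [B [_ HB]] := compact_bounded cptK.
  pose B' := `|B| + 1.
  have coB z : K z -> coord_le R B' z.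
    move=> Kz; apply: coord_leP => i; apply: le_trans (mx_coord_le_norm _ _ _ _) _.
    by apply: HB => //; rewrite /B' (le_lt_trans (ler_norm B)) // ltrDl.
  have B0 : 0 <= B' by rewrite addr_ge0.
  exists (`|Vfun (0 : 'cV[R]_9)| + 12 * B' * B') => [|z Kz].
    by rewrite addr_ge0 // !mulr_ge0.
  have : `|Vfun z - Vfun (0 : 'cV[R]_9)| <= 12 * B' * B'.
    apply: Vfun_lipschitz; [exact: coB| |].
      by apply: coord_leP => i; rewrite mxE normr0.
    move=> i; rewrite !mxE subr0; apply: le_trans (mx_coord_le_norm _ _ z i) _.
    by apply: HB => //; rewrite /B' (le_lt_trans (ler_norm B)) // ltrDl.
  by move=> /ler_normlP[_]; have := ler_norm (Vfun (0 : 'cV[R]_9)); lra.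
(* The invariant keeps V below M + Delta; the extra 1 is the width of the clipping window. *)
have M1 : 0 <= M + Delta + 1 by lra.
have [c1 flowc] := perturbed_flow_decrease R k1 k2 delta hk1 hk2 hdelta0 hdelta1 _ M1.
have [c2 jumpc] := perturbed_jump_decrease R k1 k2 delta hdelta0 _ M1.
(* [alpha1] keeps the error along flows below the margin, and [alpha2] keeps the error at jumps
   below half of the drop 4 delta. *)
pose alpha1 := margin R a M Delta / (`|c1| + 1).
pose alpha2 := 2 * delta / (`|c2| + 1).
have c10 : 0 < `|c1| + 1 by rewrite ltr_wpDl.
have c20 : 0 < `|c2| + 1 by rewrite ltr_wpDl.
have mg0 := margin_gt0 R a M Delta a0 M0 D0.
exists (Num.min 1 (Num.min alpha1 alpha2)).
  by rewrite !lt_min ltr01 !divr_gt0 // mulr_gt0.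
move=> alpha al0; rewrite !le_min => /and3P[al1].
rewrite !ler_pdivlMr // => alc1 alc2 E x [domE acx flow jump] Kx.
have {}alc1 : alpha * c1 <= margin R a M Delta.
  by apply: le_trans alc1; rewrite ler_pM2l //; have := ler_norm c1; lra.
have {}alc2 : alpha * c2 <= 2 * delta.
  by apply: le_trans alc2; rewrite ler_pM2l //; have := ler_norm c2; lra.
have [T [T0 Tge0 TE]] := hybrid_time_domainP R E domE.
pose r := Vfun (x 0 0%N).
have r0 : 0 <= r by apply: Vfun_ge0; exact: KS.
have rM : r <= M by exact: VM.
have al01 : 0 < alpha <= 1 by rewrite al0.
have slice_bound j t : E (t, j) ->
    Vfun (x (T j) j) <= decay R a r (T j + j%:R) + Delta ->
    Vfun (x t j) <= decay R a r (t + j%:R) + Delta.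
  move=> Etj; have [Tt sub _ _] := TE j t Etj.
  apply: (flow_comparison R a M r Delta (x ^~ j)) => //; first by rewrite r0.
    exact: acx.
  have [flowS flowF] := flow j.
  apply: negligibleS flowF; apply: subsetC => s H Tst.
  have sint : (slice E j)° s.
    have : `]T j, t[ `<=` slice E j by apply: subset_trans sub; exact: subset_itv_oo_cc.
    by rewrite open_subsetE; [apply; rewrite /= in_itv | exact: interval_open].
  have [v Fv dv] := H sint; exists v => // Vb.
  apply: le_trans (flowc _ _ _ al01 Vb (flowS _ sint) Fv) _.
  by rewrite lerD2l.
move=> t j; elim: j t => [|j IH] t Et; apply: slice_bound => //.
  by rewrite T0 addr0 decay0 lerDl ltW.
(* The jump lowers V by at least 4 delta - 2 delta >= a, while the comparison function loses at most
   a. *)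
have [_ _ ETj1 /(_ j erefl) ETj] := TE _ _ Et.
have [jS jG] := jump _ _ ETj ETj1.
have Vj := IH _ ETj.
have Tj0 : 0 <= T j.+1 + j%:R by rewrite addr_ge0.
have /andP[m0 mr] := decay_bounds R a r _ (ltW a0) r0 Tj0.
have := jumpc _ _ _ al01 ltac:(lra) jG.
have := decay_step R a r _ (ltW a0) r0 Tj0.
have [_ _ a_le] := rate_le R k1 k2 delta; rewrite -/a in a_le.
by rewrite -addrA natr1; lra.
Qed.
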